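(* Let $N\ge1$. The orbitals for $H_N\subset\bar{O}_N\subset S_{2^N}^+$ are as follows: (1) At $k=1$ there is $1$ orbit, for both $H_N$ and $\bar O_N$. (2) At $k=2$ there are $N+1$ orbitals, for both $H_N$ and $\bar O_N$.
   Context: $\bar O_N$ is the compact quantum group whose algebra $C(\bar O_N)$ is the universal $C^*$-algebra generated by self-adjoint elements $u_{ij}$ ($1\le i,j\le N$) such that $u=(u_{ij})$ satisfies $u^t=u^{-1}$, and such that distinct entries $u_{ij},u_{kl}$ anticommute if they lie on the same row or the same column of $u$ and commute otherwise; its comultiplication is $\Delta(u_{ij})=\sum_k u_{ik}\otimes u_{kj}$. Let $g_1,\ldots,g_N$ be the standard generators of $\mathbb Z_2^N$. The embedding $\bar O_N\subset S_{2^N}^+$ comes from the quantum isometric action of $\bar O_N$ on the $N$-hypercube: the coaction $\Phi:C^*(\mathbb Z_2^N)\to C(\bar O_N)\otimes C^*(\mathbb Z_2^N)$, $\Phi(g_i)=\sum_ju_{ij}\otimes g_j$, is transported via the Fourier isomorphism $g_1^{i_1}\cdots g_N^{i_N}\mapsto\sum_{j\in\{0,1\}^N}(-1)^{\langle i,j\rangle}\delta_{g_1^{j_1}\cdots g_N^{j_N}}$ to a coaction $\Psi(\delta_i)=\sum_kw_{i,k}\otimes\delta_k$ on $C(\mathbb Z_2^N)\simeq\mathbb C^{2^N}$ (indices $i,k\in\{0,1\}^N$, with $\delta_i=\delta_{g_1^{i_1}\cdots g_N^{i_N}}$), and $w=(w_{i,k})$ is the corresponding magic unitary. The hyperoctahedral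 group $H_N\subset\bar O_N$ of signed permutation matrices acts in this way as the usual symmetry group of the hypercube with vertex set $\{\pm1\}^N$. The number of (analytic) $k$-orbitals of a quantum subgroup $G\subset S_M^+$, with magic unitary $w$, is $\dim Fix(w^{\otimes k})=\int_G\chi^k$, where $\chi=\sum_iw_{ii}$ and $\int_G$ is the Haar state; for classical groups this is the number of orbits of $G$ on $\{1,\ldots,M\}^k$, and for $k=1,2$ it is the number of equivalence classes of the relation $(i_1,\ldots,i_k)\sim(j_1,\ldots,j_k)\iff w_{i_1j_1}\cdots w_{i_kj_k}\ne0$. *)

(* Defs.v *)
From HB Require Import structures.
From mathcomp Require Import all_boot all_order all_algebra all_fingroup.
From mathcomp Require Import all_reals.
From mathcomp Require Import complex.

Set Implicit Arguments.
Unset Strict Implicit.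
Unset Printing Implicit Defensive.
Import Order.TTheory GRing.Theory Num.Theory.
Import ComplexField.Normc.

Local Open Scope ring_scope.

Definition complete_norm (R : realType) (A : zmodType) (nrm : A -> R) : Prop :=
  forall x : nat -> A,
    (forall e, 0 < e -> exists n0 : nat, forall m n : nat,
       (n0 <= m)%N -> (n0 <= n)%N -> nrm (x m - x n) < e) ->
    exists l, forall e, 0 < e -> exists n0 : nat, forall n : nat,
      (n0 <= n)%N -> nrm (x n - l) < e.

(* Unital, nonzero C*-algebras. The norm is not taken from the hierarchy of
   normed modules, which has no join with that of algebras. *)
Record cstarAlgType (R : realType) : Type := CStarAlg {
  cstar_sort :> algType R[i] ;
  star : cstar_sort -> cstar_sort ;
  cnorm : cstar_sort -> R ;
  starK : involutive star ;
  starD : forall x y, star (x + y) = star x + star y ;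
  starZ : forall (c : R[i]) x, star (c *: x) = c^* *: star x ;
  starM : forall x y, star (x * y) = star y * star x ;
  cnorm_ge0 : forall x, 0 <= cnorm x ;
  cnorm_eq0 : forall x, cnorm x = 0 -> x = 0 ;
  cnormD : forall x y, cnorm (x + y) <= cnorm x + cnorm y ;
  cnormZ : forall (c : R[i]) x, cnorm (c *: x) = normc c * cnorm x ;
  cnormM : forall x y, cnorm (x * y) <= cnorm x * cnorm y ;
  cnorm_complete : complete_norm cnorm ;
  cnorm_star : forall x, cnorm (star x * x) = cnorm x ^+ 2
}.

(* Unital *-homomorphisms; these are automatically contractive. *)
Definition star_morphism (R : realType) (A B : cstarAlgType R)
    (f : {lrmorphism A -> B}) : Prop :=
  forall x, f (star x) = star (f x).

Definition Obar_relations (R : realType) (N : nat) (A : cstarAlgType R)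
    (u : 'M[A]_N) : Prop :=
  [/\ forall i j, star (u i j) = u i j,
      u *m u^T = 1%:M /\ u^T *m u = 1%:M,
      forall i j k l, (i, j) != (k, l) -> (i == k) || (j == l) ->
        u i j * u k l = - (u k l * u i j)
    & forall i j k l, i != k -> j != l -> u i j * u k l = u k l * u i j].

(* (A, u) is the universal C*-algebra C(\bar O_N) with its generators *)
Definition is_C_Obar (R : realType) (N : nat) (A : cstarAlgType R)
    (u : 'M[A]_N) : Prop :=
  Obar_relations u /\
  forall (B : cstarAlgType R) (v : 'M[B]_N), Obar_relations v ->
    (exists f : {lrmorphism A -> B},
       star_morphism f /\ forall i j, f (u i j) = v i j) /\
    (forall f g : {lrmorphism A -> B},
       star_morphism f -> (forall i j, f (u i j) = v i j) ->
       star_morphism g -> (forall i j, g (u i j) = v i j) -> f =1 g).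

(* The index i stands for the element g_1^{i_1} ... g_N^{i_N} of Z_2^N. *)
Notation cube N := {ffun 'I_N -> bool}.

Section HypercubeAction.
Variables (K : fieldType) (N : nat) (A : algType K) (u : 'M[A]_N).

(* An element x of {ffun cube N -> A} stands for the element
   \sum_g x g (x) g of A (x) C^*(Z_2^N); the index g + h of the group law is
   the pointwise exclusive or, and every element is its own inverse. *)
Definition conv (x y : {ffun cube N -> A}) : {ffun cube N -> A} :=
  [ffun g : cube N => \sum_(h : cube N) x h * y [ffun a => h a (+) g a]].

Definition conv1 : {ffun cube N -> A} :=
  [ffun g : cube N => (g == [ffun => false])%:R].

(* Phi(g_a) = \sum_j u_{aj} (x) g_j *)
Definition Phi_gen (a : 'I_N) : {ffun cube N -> A} :=
  [ffun g : cube N => \sum_(j < N | g == [ffun b => b == j]) u a j].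

(* Phi(g_1^{i_1} ... g_N^{i_N}), Phi being a morphism of algebras; the factors
   are multiplied in increasing order of a. *)
Definition Phi (i : cube N) : {ffun cube N -> A} :=
  \big[conv/conv1]_(a < N | i a) Phi_gen a.

(* The matrix (-1)^<i,j> of the Fourier isomorphism F *)
Definition fourier (i j : cube N) : K := (-1) ^+ (\sum_(a < N) (i a && j a)).

(* The coefficients of Psi = (id (x) F) Phi F^-1, where
   F^-1(delta_i) = 2^-N \sum_a (-1)^<i,a> g^a. *)
Definition cube_magic (i k : cube N) : A :=
  ((2 ^ N)%:R)^-1 *:
    \sum_(a : cube N) \sum_(b : cube N)
      (fourier i a * fourier b k) *: Phi a b.

End HypercubeAction.

Section Orbitals.
Variables (K : fieldType) (A : algType K) (I : finType) (w : I -> I -> A).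

(* xi in (K^I)^{(x) k} satisfies w^{(x) k} (xi (x) 1) = xi (x) 1, where
   w^{(x) k} has entries w_{i_1 j_1} ... w_{i_k j_k}. *)
Definition fixed_vector (k : nat) (xi : {ffun k.-tuple I -> K^o}) : Prop :=
  forall i : k.-tuple I,
    \sum_(j : k.-tuple I) xi j *: \prod_(a < k) w (tnth i a) (tnth j a)
    = xi i *: 1.

(* dim Fix(w^{(x) k}) = d *)
Definition nb_orbitals (k d : nat) : Prop :=
  exists V : {vspace {ffun k.-tuple I -> K^o}},
    (forall xi, xi \in V <-> fixed_vector xi) /\ \dim V = d.

End Orbitals.

(* The hyperoctahedral group: (s, e) stands for the signed permutation matrix
   with entry (-1)^{e_i} at each position (i, s i). *)
Definition hyperoct (N : nat) : finType := ('S_N * {ffun 'I_N -> bool})%type.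

Definition signed_perm_mx (K : fieldType) (N : nat) (h : hyperoct N) : 'M[K]_N :=
  diag_mx (\row_i (-1) ^+ h.2 i) *m perm_mx h.1.

Definition C_hyperoct (K : fieldType) (N : nat) : Type :=
  {ffun hyperoct N -> K^o}.

Section CHyperoctAlgebra.
Variables (K : fieldType) (N : nat).

HB.instance Definition _ := GRing.PzRing.on (C_hyperoct K N).
HB.instance Definition _ := GRing.Lmodule.on (C_hyperoct K N).

Fact C_hyperoct_oner_neq0 : (1 : C_hyperoct K N) != 0.
Proof.
apply/eqP => /ffunP /(_ (1%g, [ffun => false])) /eqP.
by rewrite !ffunE oner_eq0.
Qed.
HB.instance Definition _ :=
  GRing.PzSemiRing_isNonZero.Build (C_hyperoct K N) C_hyperoct_oner_neq0.

Fact C_hyperoct_scalerAl (c : K) (x y : C_hyperoct K N) :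
  c *: (x * y) = c *: x * y.
Proof. by apply/ffunP => h; rewrite !ffunE; exact: scalerAl. Qed.
HB.instance Definition _ :=
  GRing.LSemiModule_isLSemiAlgebra.Build K (C_hyperoct K N) C_hyperoct_scalerAl.

Fact C_hyperoct_scalerAr (c : K) (x y : C_hyperoct K N) :
  c *: (x * y) = x * (c *: y).
Proof. by apply/ffunP => h; rewrite !ffunE; exact: scalerAr. Qed.
HB.instance Definition _ :=
  GRing.LSemiAlgebra_isSemiAlgebra.Build K (C_hyperoct K N) C_hyperoct_scalerAr.

End CHyperoctAlgebra.

(* The coordinate functions on H_N *)
Definition hyperoct_u (K : fieldType) (N : nat) : 'M[C_hyperoct K N]_N :=
  \matrix_(i, j) [ffun h => signed_perm_mx K h i j].

(* Main.v *)
Require Import Defs.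
From HB Require Import structures.
From mathcomp Require Import all_boot all_order all_algebra all_fingroup.
From mathcomp Require Import all_classical all_reals.
From mathcomp Require Import complex lra.

(** The Fourier isomorphism conjugates the magic unitary w of the cube into the
    matrix Phi u of the coaction on the group algebra of Z_2^N, in the basis of
    group elements. Conjugation by a scalar matrix does not change the dimension
    of the space of vectors fixed by a tensor power (nb_orbitals_conj), so one has
    to count the fixed vectors of the tensor powers of Phi u.

    For the lower bound, write X_a for the image of the generator g_a, which is the
    sum over j of u_aj g_j. The relations on u show that the X_a commute and square
    to 1. The main point is that Phi preserves the degree, that is, the number of
    generators in a group element (Phi_graded). Let d_i be the projection on the
    span of the group elements that involve g_i. It satisfies a Leibniz rule
    twisted by the automorphism g_i -> - g_i, and the anticommutation of u in
    columns absorbs this twist on products of the X_a. Hence d_i maps a product Z of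
    distinct X_r to the sum over r of u_ri g_i X_r Z. Summing over i gives the sum
    over r of X_r X_r Z, which is deg(Z) times Z, while the sum of the d_i is the
    degree operator. As Phi is multiplicative, the coefficient of the group unit in
    Phi(g^a) Phi(g^b) then yields the relation Phi_orthogonal: the sum over c of
    Phi(a,c) Phi(b,c) is 1 if a = b and 0 otherwise. So the group unit is fixed for
    k = 1, and for k = 2 the sum of g (x) g over the g of degree d is fixed, for each
    d from 0 to N.

    For the upper bound, it suffices to evaluate at the points of H_N. Diagonal sign
    matrices force a fixed vector to be supported at the group unit (k = 1), or at
    the pairs (g, g) (k = 2), and permutation matrices make the coordinates at
    (g, g) depend on the degree of g only.

    The argument rests on the relations of the generators and the existence
    of these evaluations (cube_magic_orbitals). The algebra of functions on H_N has
    them by definition; the universal algebra of the quantum group has them because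
    signed permutation matrices satisfy its relations over the C*-algebra of complex
    numbers (Obar_points). *)

Set Implicit Arguments.
Unset Strict Implicit.
Unset Printing Implicit Defensive.
Import Order.TTheory GRing.Theory Num.Theory.
Import ComplexField.Normc.

Local Open Scope ring_scope.

(** * Sums and products over tuples *)

(** Distributivity holds over tuples in any ring, the order of the factors being
    kept; it is what makes tensor powers multiplicative when one of the two
    matrices has scalar entries. *)
Lemma prod_sum_tuple (A : pzSemiRingType) (I : finType) (k : nat)
    (G : 'I_k -> I -> A) :
  \prod_(s < k) \sum_(j : I) G s j
  = \sum_(t : k.-tuple I) \prod_(s < k) G s (tnth t s).
Proof.
rewrite bigA_distr_bigA (reindex (fun t : k.-tuple I => [ffun s => tnth t s])) /=.
  by apply: eq_bigr => t _; apply: eq_bigr => s _; rewrite ffunE.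
exists (fun f : {ffun 'I_k -> I} => [tuple f s | s < k]) => [t|f] _.
  by apply: eq_from_tnth => s; rewrite tnth_mktuple ffunE.
by apply/ffunP => s; rewrite ffunE tnth_mktuple.
Qed.

Lemma sum_tuple1 (V : nmodType) (I : finType) (F : 1.-tuple I -> V) :
  \sum_(t : 1.-tuple I) F t = \sum_(x : I) F [tuple x].
Proof.
rewrite (reindex (fun x : I => [tuple x])) //=.
exists (fun t : 1.-tuple I => tnth t ord0) => [x|t] _ //=.
by apply: eq_from_tnth => s; rewrite [s]ord1 tnth0.
Qed.

Lemma sum_tuple2 (V : nmodType) (I : finType) (F : 2.-tuple I -> V) :
  \sum_(t : 2.-tuple I) F t = \sum_(x : I) \sum_(y : I) F [tuple x; y].
Proof.
rewrite pair_big (reindex (fun p : I * I => [tuple p.1; p.2])) //=.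
exists (fun t : 2.-tuple I => (tnth t ord0, tnth t ord_max)) => [[x y]|t] _ //=.
by apply: val_inj; case: t => [[|a [|b []]]].
Qed.

Lemma big_ord2 (R : Type) (idx : R) (op : Monoid.law idx) (F : 'I_2 -> R) :
  \big[op/idx]_(s < 2) F s = op (F ord0) (F ord_max).
Proof.
by rewrite big_ord_recl big_ord1; congr (op _ (F _)); apply: val_inj.
Qed.

Lemma tuple2P (T : Type) (P : 2.-tuple T -> Prop) :
  (forall a b, P [tuple a; b]) -> forall t, P t.
Proof.
move=> Pab [[|a [|b []]]] // ab_size.
by rewrite (_ : Tuple ab_size = [tuple a; b]) //; apply: val_inj.
Qed.

Lemma tnth_pair (T : Type) (a b : T) :
  (tnth [tuple a; b] ord0 = a) * (tnth [tuple a; b] ord_max = b).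
Proof. by split. Qed.

Lemma prod_tuple_eq (K : comPzSemiRingType) (I : eqType) k (i j : k.-tuple I) :
  \prod_(s < k) ((tnth i s == tnth j s)%:R : K) = (i == j)%:R.
Proof.
have [->|nij] := eqVneq i j; first by rewrite big1 // => s _; rewrite eqxx.
have /existsP [s /negbTE nij_s] : [exists s, tnth i s != tnth j s].
  apply: contraNT nij => /existsPn eqij; apply/eqP/eq_from_tnth => s.
  by apply/eqP; rewrite -[_ == _]negbK eqij.
by rewrite (bigD1 s) //= nij_s mul0r.
Qed.

(** * Fixed vectors under a change of basis *)

Section TensorPower.
Variables (K : fieldType) (I : finType).

Definition tensor_apply (S : I -> I -> K) (k : nat)
    (xi : {ffun k.-tuple I -> K^o}) : {ffun k.-tuple I -> K^o} :=
  [ffun i : k.-tuple I =>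
     \sum_(a : k.-tuple I) (\prod_(s < k) S (tnth i s) (tnth a s)) *: xi a].

Definition inverse_kernels (S S' : I -> I -> K) : Prop :=
  forall i j, \sum_a S i a * S' a j = (i == j)%:R.

Fact tensor_apply_is_linear S k : linear (@tensor_apply S k).
Proof.
move=> c x y; apply/ffunP => i; rewrite !ffunE scaler_sumr -big_split /=.
apply: eq_bigr => a _; rewrite !ffunE scalerDr !scalerA mulrC.
by congr (_ + _).
Qed.
HB.instance Definition _ S k := GRing.isLinear.Build K _ _ *:%R
  (@tensor_apply S k) (@tensor_apply_is_linear S k).

Lemma tensor_applyK S S' k :
  inverse_kernels S' S -> cancel (@tensor_apply S k) (@tensor_apply S' k).
Proof.
move=> SS xi; apply/ffunP => i; rewrite ffunE.
under eq_bigr => a _ do rewrite ffunE scaler_sumr.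
rewrite exchange_big /= (bigD1 i) //= [X in _ + X]big1 ?addr0.
- under eq_bigr => a _ do rewrite scalerA -big_split /=.
  rewrite -scaler_suml -(prod_sum_tuple (fun s j => S' (tnth i s) j * S j (tnth i s))).
  by rewrite big1 ?scale1r // => s _; rewrite SS eqxx.
- move=> j nij.
  under eq_bigr => a _ do rewrite scalerA -big_split /=.
  rewrite -scaler_suml -(prod_sum_tuple (fun s c => S' (tnth i s) c * S c (tnth j s))).
  under eq_bigr => s _ do rewrite SS.
  by rewrite prod_tuple_eq eq_sym (negbTE nij) scale0r.
Qed.

End TensorPower.

Section ChangeOfBasis.
Variables (K : fieldType) (A : algType K) (I : finType).

Definition intertwines (S : I -> I -> K) (w P : I -> I -> A) : Prop :=
  forall i b, \sum_j S j b *: w i j = \sum_a S i a *: P a b.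

(** An intertwiner of two matrices intertwines their tensor powers: the scalar
    entries of S can be moved through the product of the entries of w, one
    tensor factor at a time. *)
Lemma fixed_vector_tensor_apply S w P k (xi : {ffun k.-tuple I -> K^o}) :
  intertwines S w P -> fixed_vector P xi -> fixed_vector w (tensor_apply S xi).
Proof.
move=> SwP fix_xi i.
transitivity (\sum_(b : k.-tuple I) xi b *:
   \sum_(j : k.-tuple I) \prod_(s < k) (S (tnth j s) (tnth b s) *: w (tnth i s) (tnth j s))).
  under eq_bigr => j _ do rewrite ffunE scaler_suml.
  rewrite exchange_big /=; apply: eq_bigr => b _.
  rewrite scaler_sumr; apply: eq_bigr => j _.
  by rewrite scaler_prod scalerA mulrC.
under eq_bigr => b _.
  rewrite -(prod_sum_tuple (fun s j => S j (tnth b s) *: w (tnth i s) j)).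
  under eq_bigr => s _ do rewrite SwP.
  rewrite (prod_sum_tuple (fun s a => S (tnth i s) a *: P a (tnth b s))) scaler_sumr.
  over.
rewrite exchange_big ffunE scaler_suml /=; apply: eq_bigr => a _.
rewrite -scalerA -fix_xi scaler_sumr; apply: eq_bigr => b _.
by rewrite scaler_prod !scalerA mulrC.
Qed.

Lemma nb_orbitals_intertwines T T' (w P : I -> I -> A) k d :
  inverse_kernels T T' -> inverse_kernels T' T ->
  intertwines T w P -> intertwines T' P w ->
  nb_orbitals P k d -> nb_orbitals w k d.
Proof.
move=> TT' T'T wP Pw [V [VP dimV]].
have TK := tensor_applyK T'T (k := k); have T'K := tensor_applyK TT' (k := k).
exists (linfun (tensor_apply T (k := k)) @: V)%VS; split.
  move=> xi; split.
    case/memv_imgP => eta /VP fix_eta ->; rewrite lfunE.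
    exact: fixed_vector_tensor_apply fix_eta.
  move=> fix_xi; apply/memv_imgP; exists (tensor_apply T' xi).
    by apply/VP; exact: fixed_vector_tensor_apply fix_xi.
  by rewrite lfunE /= T'K.
rewrite -dimV; apply: limg_dim_eq; apply/eqP; rewrite -subv0.
apply/subvP => xi /memv_capP [_]; rewrite memv_ker lfunE /= memv0 => /eqP xi0.
by rewrite -[xi]TK xi0 linear0.
Qed.

(** The matrix w is T P T', with T and T' inverse to each other, so T and T'
    intertwine w and P in both directions. *)
Lemma nb_orbitals_conj T T' (w P : I -> I -> A) k d :
  inverse_kernels T T' -> inverse_kernels T' T ->
  (forall i j, w i j = \sum_a \sum_b (T i a * T' b j) *: P a b) ->
  nb_orbitals P k d -> nb_orbitals w k d.
Proof.
move=> TT' T'T wE; apply: nb_orbitals_intertwines => // i b.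
- under eq_bigr => j _ do rewrite wE scaler_sumr.
  rewrite exchange_big; apply: eq_bigr => a _ /=.
  under eq_bigr => j _ do rewrite scaler_sumr.
  rewrite exchange_big (bigD1 b) //= [X in _ + X]big1 => [|c ncb].
    under eq_bigr => j _ do rewrite scalerA mulrC -mulrA.
    by rewrite -scaler_suml -mulr_sumr T'T eqxx mulr1 addr0.
  under eq_bigr => j _ do rewrite scalerA mulrC -mulrA.
  by rewrite -scaler_suml -mulr_sumr T'T (negbTE ncb) mulr0 scale0r.
- under [RHS]eq_bigr => j _ do rewrite wE scaler_sumr.
  rewrite [RHS]exchange_big [RHS](bigD1 i) //= [X in _ = _ + X]big1 => [|c nci].
    rewrite addr0; under [RHS]eq_bigr => j _ do rewrite scaler_sumr.
    rewrite [RHS]exchange_big; apply: eq_bigr => c _ /=.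
    under eq_bigr => j _ do rewrite scalerA mulrA.
    by rewrite -scaler_suml -mulr_suml T'T eqxx mul1r.
  under eq_bigr => j _ do rewrite scaler_sumr.
  rewrite exchange_big big1 //= => b' _.
  under eq_bigr => j _ do rewrite scalerA mulrA.
  by rewrite -scaler_suml -mulr_suml T'T eq_sym (negbTE nci) mul0r scale0r.
Qed.

(** The evaluations at the points p form a basis dual to eta, which gives both
    the independence of eta and the coordinates of a fixed vector. *)
Lemma nb_orbitals_dual_family (w : I -> I -> A) k d (eta : 'I_d -> {ffun k.-tuple I -> K^o})
    (p : 'I_d -> k.-tuple I) :
  (forall r, fixed_vector w (eta r)) ->
  (forall r q, eta r (p q) = (r == q)%:R) ->
  (forall xi, fixed_vector w xi -> xi = \sum_r xi (p r) *: eta r) ->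
  nb_orbitals w k d.
Proof.
move=> fix_eta eta_p fix_span; exists <<mktuple eta>>%VS; split.
  move=> xi; split=> [/coord_span -> i | /fix_span ->].
    under eq_bigr => j _ do rewrite sum_ffunE scaler_suml.
    rewrite exchange_big sum_ffunE scaler_suml; apply: eq_bigr => r _.
    rewrite ffunE -scalerA nth_mktuple -fix_eta scaler_sumr; apply: eq_bigr => j _.
    by rewrite ffunE scalerA.
  apply: rpred_sum => r _; apply: rpredZ; apply: memv_span.
  by rewrite -(tnth_mktuple eta r) mem_tnth.
rewrite -[RHS](size_tuple (mktuple eta)); apply/eqP; apply/freeP => c eq0 q.
have /ffunP /(_ (p q)) := eq0; rewrite sum_ffunE ffunE (bigD1 q) //=.
rewrite ffunE nth_mktuple eta_p eqxx big1 ?addr0 => [|r nrq].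
  by move=> <-; rewrite /GRing.scale /= mulr1.
by rewrite ffunE nth_mktuple eta_p (negbTE nrq) scaler0.
Qed.

End ChangeOfBasis.

(** * The group algebra of the cube *)

Section Cube.
Variable N : nat.
Implicit Types g h l : cube N.

Definition cube0 : cube N := [ffun => false].
Definition cubeD g h : cube N := [ffun a => g a (+) h a].
Definition cube1 (j : 'I_N) : cube N := [ffun b => b == j].
Definition weight g : nat := \sum_(a < N) g a.

Lemma cubeDC g h : cubeD g h = cubeD h g.
Proof. by apply/ffunP => a; rewrite !ffunE addbC. Qed.

Lemma cubeDA g h l : cubeD g (cubeD h l) = cubeD (cubeD g h) l.
Proof. by apply/ffunP => a; rewrite !ffunE addbA. Qed.

Lemma cubeDK g : involutive (cubeD g).
Proof. by move=> h; apply/ffunP => a; rewrite !ffunE addKb. Qed.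

Lemma cubeD0 g : cubeD g cube0 = g.
Proof. by apply/ffunP => a; rewrite !ffunE addbF. Qed.

Lemma cubeDg g : cubeD g g = cube0.
Proof. by apply/ffunP => a; rewrite !ffunE addbb. Qed.

Lemma cubeD_eq0 g h : (cubeD g h == cube0) = (g == h).
Proof.
apply/eqP/eqP => [gh0|->]; last exact: cubeDg.
by rewrite -[RHS](cubeDK g) gh0 cubeD0.
Qed.

Lemma cube_neq g h : g != h -> exists i, g i != h i.
Proof.
move=> ngh; apply/existsP; apply: contraNT ngh => /existsPn eqgh.
by apply/eqP/ffunP => i; apply/eqP; rewrite -[_ == _]negbK eqgh.
Qed.

Lemma cube_neq0 g : g != cube0 -> exists i, g i.
Proof. by case/cube_neq => i; rewrite ffunE => gi; exists i; case: (g i) gi. Qed.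

Lemma weight_card g : weight g = #|[pred a | g a]|.
Proof.
rewrite /weight -sum1_card [RHS]big_mkcond; apply: eq_bigr => a _.
by rewrite inE; case: (g a).
Qed.

Lemma weight_eq0 g : (weight g == 0)%N = (g == cube0).
Proof.
rewrite sum_nat_eq0; apply/forallP/eqP => [g0|-> a]; last by rewrite ffunE.
by apply/ffunP => a; rewrite ffunE; have := g0 a; case: (g a).
Qed.

Lemma weight_le g : (weight g <= N)%N.
Proof. by rewrite weight_card -[leqRHS]card_ord max_card. Qed.

End Cube.
Arguments cube0 {N}.

(** The tensor product of A with the group algebra of Z_2^N; the alias keeps the
    convolution apart from the pointwise product of functions. *)
Definition cube_alg (K : fieldType) (N : nat) (A : algType K) : Type :=
  {ffun cube N -> A}.

Section CubeAlgebra.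
Variables (K : fieldType) (N : nat) (A : algType K).
Local Notation AG := (cube_alg N A).
HB.instance Definition _ := GRing.Zmodule.on AG.

Let mul (x y : AG) : AG := conv x y.
Let one : AG := conv1 N A.

Let mulE x y g : mul x y g = \sum_h x h * y (cubeD h g).
Proof. by rewrite /mul ffunE. Qed.

Fact cube_alg_mulA : associative mul.
Proof.
move=> x y z; apply/ffunP => g; rewrite !mulE.
under [RHS]eq_bigr => l _ do rewrite mulE mulr_suml.
rewrite exchange_big /=; apply: eq_bigr => h _.
rewrite mulE mulr_sumr (reindex_inj (can_inj (cubeDK h))) /=.
apply: eq_bigr => l _; rewrite mulrA cubeDA; congr (_ * z _).
by rewrite [cubeD (cubeD h l) h]cubeDC cubeDK.
Qed.

Fact cube_alg_mul1r : left_id one mul.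
Proof.
move=> x; apply/ffunP => g; rewrite mulE (bigD1 cube0) //= ffunE eqxx mul1r.
rewrite cubeDC cubeD0 big1 ?addr0 // => h /negbTE nh0.
by rewrite ffunE nh0 mul0r.
Qed.

Fact cube_alg_mulr1 : right_id one mul.
Proof.
move=> x; apply/ffunP => g; rewrite mulE (bigD1 g) //= ffunE -/cube0.
rewrite cubeD_eq0 eqxx mulr1 big1 ?addr0 // => h nhg.
by rewrite ffunE -/cube0 cubeD_eq0 (negbTE nhg) mulr0.
Qed.

Fact cube_alg_mulDl : left_distributive mul +%R.
Proof.
move=> x y z; apply/ffunP => g; rewrite [RHS]ffunE !mulE -big_split /=.
by apply: eq_bigr => h _; rewrite ffunE mulrDl.
Qed.

Fact cube_alg_mulDr : right_distributive mul +%R.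
Proof.
move=> x y z; apply/ffunP => g; rewrite [RHS]ffunE !mulE -big_split /=.
by apply: eq_bigr => h _; rewrite ffunE mulrDr.
Qed.

HB.instance Definition _ := GRing.Zmodule_isPzRing.Build AG
  cube_alg_mulA cube_alg_mul1r cube_alg_mulr1 cube_alg_mulDl cube_alg_mulDr.

Lemma cube_algME (x y : AG) g : (x * y) g = \sum_h x h * y (cubeD h g).
Proof. exact: mulE. Qed.

Lemma cube_alg1E g : (1 : AG) g = (g == cube0)%:R.
Proof. by rewrite ffunE. Qed.

Definition monom (g : cube N) (c : A) : AG := [ffun h => c *+ (h == g)].

Lemma monomM g h c d : monom g c * monom h d = monom (cubeD g h) (c * d).
Proof.
apply/ffunP => l; rewrite cube_algME ffunE (bigD1 g) //= !ffunE eqxx mulr1n.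
rewrite big1 ?addr0 => [|k /negbTE nkg]; last by rewrite ffunE nkg mul0r.
by rewrite mulrnAr (can2_eq (cubeDK g) (cubeDK g)).
Qed.

Fact monom_is_zmod_morphism g : zmod_morphism (monom g).
Proof. by move=> c d; apply/ffunP => h; rewrite !ffunE mulrnBl. Qed.
HB.instance Definition _ g :=
  GRing.isZmodMorphism.Build A AG (monom g) (monom_is_zmod_morphism g).

Lemma monom1 : monom cube0 1 = 1.
Proof. apply/ffunP => g; rewrite [LHS]ffunE cube_alg1E; reflexivity. Qed.

(** The part of x that is odd under the automorphism g_i -> - g_i. *)
Definition odd_part (i : 'I_N) (x : AG) : AG := [ffun g : cube N => x g *+ g i].
(** The automorphism g_i -> - g_i. *)
Definition flip (i : 'I_N) (x : AG) : AG := [ffun g : cube N => (-1) ^+ g i * x g].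

(** A group element involves g_i in a product exactly when one of the two factors
    does and not the other, hence a skew Leibniz rule instead of a Leibniz rule. *)
Lemma odd_partM i x y : odd_part i (x * y) = odd_part i x * y + flip i x * odd_part i y.
Proof.
apply/ffunP => g; rewrite ffunE [RHS]ffunE !cube_algME -big_split /= -sumrMnl.
apply: eq_bigr => h _; rewrite !ffunE.
by case: (h i) (g i) => [] [] /=; rewrite ?mulr0n ?mulr1n ?mulr0 ?mul0r
  ?addr0 ?add0r ?expr0 ?mul1r ?expr1 ?mulN1r ?mulNr ?subrr.
Qed.

(** This is the degree operator, which multiplies a group element by the number of
    generators in it. *)
Lemma sum_odd_part x g : (\sum_i odd_part i x) g = x g *+ weight g.
Proof. by rewrite sum_ffunE -sumrMnr; apply: eq_bigr => i _; rewrite ffunE. Qed.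

End CubeAlgebra.

(** * The coaction preserves the degree *)

Section Char0.
Variables (K : fieldType) (A : algType K).
Hypothesis char0 : [pchar K] =i pred0.

Lemma mulrn_torsion_free (x : A) n : (0 < n)%N -> x *+ n = 0 -> x = 0.
Proof.
move=> n0; rewrite -scaler_nat => /eqP; rewrite scaler_eq0.
by rewrite ((pcharf0P _).1 char0) eqn0Ngt n0 => /eqP.
Qed.

Lemma mulrn_torsion_free_inj (x : A) m n : x *+ m = x *+ n -> m != n -> x = 0.
Proof.
wlog lemn : m n / (m <= n)%N => [hw|].
  by case/orP: (leq_total m n) => /hw // H /esym /H; rewrite eq_sym.
move=> /eqP; rewrite eq_sym -subr_eq0 -mulrnBr // => /eqP e nmn.
by apply: mulrn_torsion_free e; rewrite subn_gt0 ltn_neqAle nmn.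
Qed.

Lemma eq_oppr_eq0 (x : A) : x = - x -> x = 0.
Proof.
move=> xN; apply: (mulrn_torsion_free (n := 2)) => //.
by rewrite mulr2n {1}xN addNr.
Qed.

End Char0.

Lemma sum_offdiag_swap (V : nmodType) (I : finType) (F : I -> I -> V) :
  \sum_j \sum_(l | l != j) F j l = \sum_j \sum_(l | l != j) F l j.
Proof.
rewrite (exchange_big_dep xpredT) //=; apply: eq_bigr => j _.
by apply: eq_bigl => l; rewrite eq_sym.
Qed.

Section Coaction.
Variables (K : fieldType) (N : nat) (A : algType K) (u : 'M[A]_N).
Local Notation AG := (cube_alg N A).

(** Phi_gen seen in the group algebra, so that products are convolutions. *)
Definition gen (a : 'I_N) : AG := Phi_gen u a.
Definition entry (a j : 'I_N) : AG := monom (cube1 j) (u a j).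

Lemma PhiE i : Phi u i = \prod_(a < N | i a) gen a :> AG.
Proof. by []. Qed.

Lemma genE a : gen a = \sum_j entry a j.
Proof.
apply/ffunP => g; rewrite ffunE sum_ffunE big_mkcond.
by apply: eq_bigr => j _; rewrite ffunE mulrb.
Qed.

Lemma monom_mulE g c (x : AG) h : (monom g c * x) h = c * x (cubeD g h).
Proof.
rewrite cube_algME (bigD1 g) //= ffunE eqxx big1 ?addr0 // => l /negbTE nlg.
by rewrite ffunE nlg mul0r.
Qed.

Lemma gen_mulE a (x : AG) h : (gen a * x) h = \sum_j u a j * x (cubeD (cube1 j) h).
Proof.
by rewrite genE mulr_suml sum_ffunE; apply: eq_bigr => j _; rewrite monom_mulE.
Qed.

Lemma cube1E (i j : 'I_N) : cube1 j i = (i == j).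
Proof. by rewrite ffunE. Qed.

Lemma odd_part_gen i a : odd_part i (gen a) = entry a i.
Proof.
apply/ffunP => g; rewrite ffunE genE sum_ffunE -sumrMnl (bigD1 i) //= big1 => [|j nji].
  by rewrite addr0 ffunE; case: eqP => [->|_]; rewrite ?cube1E ?eqxx // mul0rn.
by rewrite ffunE; case: eqP => [->|_]; rewrite ?cube1E ?mul0rn // eq_sym (negbTE nji).
Qed.

Lemma flip_gen i a :
  flip i (gen a) = \sum_j monom (cube1 j) ((-1) ^+ (i == j) * u a j).
Proof.
apply/ffunP => g; rewrite ffunE genE !sum_ffunE mulr_sumr.
apply: eq_bigr => j _; rewrite !ffunE.
by case: eqP => [->|_]; rewrite ?cube1E ?mulr1n // !mulr0n mulr0.
Qed.

Hypothesis char0 : [pchar K] =i pred0.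
Hypothesis orth_u : u *m u^T = 1%:M.
Hypothesis anti_u : forall i j k l, (i, j) != (k, l) -> (i == k) || (j == l) ->
  u i j * u k l = - (u k l * u i j).
Hypothesis comm_u : forall i j k l, i != k -> j != l ->
  u i j * u k l = u k l * u i j.

(** Orthogonality of the rows a and b evaluates the terms in which both factors
    contribute the same group generator. *)
Lemma gen_mul a b : gen a * gen b = (a == b)%:R +
  \sum_j \sum_(l | l != j) monom (cubeD (cube1 j) (cube1 l)) (u a j * u b l).
Proof.
rewrite !genE mulr_suml.
under eq_bigr => j _ do rewrite mulr_sumr (bigD1 j) //= monomM cubeDg.
rewrite big_split /=; congr (_ + _); last first.
  by apply: eq_bigr => j _; apply: eq_bigr => l _; rewrite monomM.
have orth_ab : \sum_j u a j * u b j = (a == b)%:R.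
  have /matrixP /(_ a b) := orth_u; rewrite !mxE => <-.
  by apply: eq_bigr => j _; rewrite mxE.
rewrite -raddf_sum /= orth_ab; case: (a == b); last by rewrite raddf0.
by rewrite mulr1n monom1.
Qed.

(** Off the diagonal the entries of u are in different rows and columns, so they
    commute; the diagonal terms vanish by orthogonality. *)
Lemma gen_comm a b : GRing.comm (gen a) (gen b).
Proof.
have [->|nab] := eqVneq a b; first by [].
rewrite /GRing.comm !gen_mul [b == a]eq_sym (negbTE nab); congr (_ + _).
rewrite [RHS]sum_offdiag_swap; apply: eq_bigr => j _; apply: eq_bigr => l nlj.
by rewrite cubeDC comm_u // eq_sym.
Qed.

(** Off the diagonal the two entries of u are in the same row, so the sum is
    antisymmetric under exchange of its indices. *)
Lemma gen_sqr a : gen a * gen a = 1.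
Proof.
rewrite gen_mul eqxx; set S := (\sum_j _).
suff -> : S = 0 by rewrite addr0.
have SN : S = - S.
  rewrite {1}/S sum_offdiag_swap -sumrN; apply: eq_bigr => j _.
  rewrite -sumrN; apply: eq_bigr => l nlj.
  rewrite cubeDC -raddfN /= anti_u ?eqxx //.
  by apply: contraNneq nlj => -[->].
apply/ffunP => g; rewrite [RHS]ffunE; apply: (eq_oppr_eq0 char0).
by have /ffunP /(_ g) := SN; rewrite [in RHS]ffunE.
Qed.

(** The sign produced by g_i -> - g_i is the one by which entries of u in the same
    column anticommute, so the skew Leibniz rule becomes an untwisted one on
    products of the commuting elements gen r. *)
Lemma flip_gen_mul_entry i r s : r != s -> flip i (gen s) * entry r i = entry r i * gen s.
Proof.
move=> nrs; rewrite flip_gen genE mulr_suml mulr_sumr; apply: eq_bigr => j _.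
rewrite !monomM cubeDC; congr monom; have [<-|nij] := eqVneq i j.
  rewrite mulN1r mulNr [RHS]anti_u ?eqxx ?orbT //.
  by apply: contraNneq nrs => -[->].
by rewrite mul1r comm_u // eq_sym.
Qed.

(** Deleting gen r from the product is the same as multiplying it by gen r, since
    the factors commute and square to 1; so the expected Leibniz formula, where
    entry r i replaces gen r, takes this form. *)
Lemma odd_part_prod i (l : seq 'I_N) : uniq l ->
  odd_part i (\prod_(r <- l) gen r)
  = \sum_(r <- l) entry r i * gen r * \prod_(r <- l) gen r.
Proof.
elim: l => [_|s l IHl /= /andP [nsl /IHl {}IHl]].
  rewrite !big_nil; apply/ffunP => g; rewrite [LHS]ffunE [RHS]ffunE cube_alg1E.
  by case: eqP => [->|_]; rewrite ?ffunE // mul0rn.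
rewrite !big_cons; move: IHl; set Z := \prod_(r <- l) gen r => IHl.
rewrite odd_partM odd_part_gen IHl mulrA -[_ * gen s * gen s]mulrA gen_sqr mulr1; congr (_ + _).
rewrite mulr_sumr big_seq [RHS]big_seq; apply: eq_bigr => r rl.
rewrite !mulrA flip_gen_mul_entry; last by apply: contraNneq nsl => <-.
by congr (_ * _); rewrite -!mulrA; congr (_ * _); exact: gen_comm.
Qed.

(** Since the terms of gen r add up to gen r and gen r squares to 1, summing the
    previous formula over i shows that a product of m distinct gen r is an
    eigenvector of the degree operator, with eigenvalue m. *)
Lemma Phi_graded a b : weight a != weight b -> Phi u a b = 0.
Proof.
set l : seq 'I_N := [seq r <- index_enum 'I_N | a r].
have ul : uniq l by rewrite filter_uniq ?index_enum_uniq.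
have PZ : Phi u a = \prod_(r <- l) gen r :> AG by rewrite PhiE big_filter.
have sl : size l = weight a by rewrite size_filter -sum1_count weight_card -sum1_card.
rewrite eq_sym; apply: (mulrn_torsion_free_inj char0).
rewrite PZ -sum_odd_part -sl (eq_bigr _ (fun i _ => odd_part_prod i ul)).
rewrite exchange_big /=.
under eq_bigr => r _ do rewrite -!mulr_suml -genE gen_sqr mul1r.
by rewrite big_const_seq count_predT iter_addr_0 ffunMnE.
Qed.

Lemma PhiM a b : (Phi u a : AG) * Phi u b = Phi u (cubeD a b).
Proof.
rewrite !PhiE; elim: index_enum => [|r l IHl]; first by rewrite !big_nil mulr1.
rewrite !big_cons -IHl ffunE.
have comm_r (P : pred 'I_N) : GRing.comm (gen r) (\prod_(s <- l | P s) gen s).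
  by apply: commr_prod => s _; exact: gen_comm.
case: (a r) (b r) => [] [] //=.
- by rewrite mulrA -[_ * gen r]mulrA -comm_r mulrA gen_sqr mul1r.
- by rewrite mulrA.
- by rewrite mulrA -comm_r mulrA.
Qed.

Lemma Phi0 : Phi u cube0 = 1 :> AG.
Proof. by rewrite PhiE big_pred0 // => a; rewrite ffunE. Qed.

Lemma Phi_to_cube0 a : Phi u a cube0 = (a == cube0)%:R.
Proof.
have [->|na0] := eqVneq a cube0; first by rewrite Phi0 cube_alg1E eqxx.
apply: Phi_graded; rewrite -weight_eq0 in na0.
by have /eqP -> : weight (@cube0 N) == 0 by rewrite weight_eq0.
Qed.

(** The left-hand side is the coefficient of the unit of the group in
    Phi u a * Phi u b = Phi u (cubeD a b). *)
Lemma Phi_orthogonal a b : \sum_g Phi u a g * Phi u b g = (a == b)%:R.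
Proof.
rewrite -cubeD_eq0 -Phi_to_cube0 -PhiM cube_algME.
by apply: eq_bigr => g _; rewrite cubeD0.
Qed.

End Coaction.

(** * Fixed vectors in the basis of group elements *)

Definition cube_act N (s : 'S_N) (a : cube N) : cube N := [ffun j => a ((s^-1)%g j)].
(** A representative of the cube elements of weight d. *)
Definition initial_cube N (d : nat) : cube N := [ffun i : 'I_N => (i < d)%N].

Lemma weight_initial_cube N d : (d <= N)%N -> weight (initial_cube N d) = d.
Proof.
move=> led; rewrite /weight; under eq_bigr => i _ do rewrite ffunE.
rewrite -(big_mkord xpredT (fun i => nat_of_bool (i < d)%N)) (big_cat_nat (n := d)) //=.
rewrite big_nat_cond; under eq_bigr => i /andP [/andP [_ ->] _] do [].
rewrite -big_nat_cond sum_nat_const_nat muln1 subn0 big_nat_cond big1 ?addn0 //.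
by move=> i /andP [/andP [ledi _] _]; rewrite ltnNge ledi.
Qed.

(** As tuples of booleans, a and b have the same number of entries of each value,
    so they are permutations of each other. *)
Lemma cube_act_transitive N (a b : cube N) :
  weight a = weight b -> exists s : 'S_N, cube_act s a = b.
Proof.
move=> wab.
have count_fgraph (c : cube N) P : count P [tuple c i | i < N]
    = (P true * weight c + P false * (N - weight c))%N.
  rewrite count_map -sum1_count big_enum_cond /=.
  transitivity (\sum_(i < N) (P true * c i + P false * ~~ c i))%N.
    rewrite big_mkcond; apply: eq_bigr => i _ /=.
    by case: (c i); case: (P true); case: (P false).
  rewrite big_split /= -!big_distrr /=; congr (_ + _ * _)%N.
  rewrite -[N in (N - _)%N]card_ord -sum1_card -(addnK (weight c) (\sum_i _)%N).
  congr (_ - _)%N; rewrite -big_split /=; apply: eq_bigr => i _.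
  by case: (c i).
have /tuple_permP [s es] : perm_eq [tuple b i | i < N] [tuple a i | i < N].
  by apply/seq.permP => P; rewrite !count_fgraph wab.
exists (s^-1)%g; apply/ffunP => i; rewrite ffunE invgK.
have /val_inj /(congr1 (fun t => tnth t i)) := es.
by rewrite !tnth_mktuple.
Qed.

Section Points.
Variables (K : fieldType) (N : nat) (A : algType K) (u : 'M[A]_N).
Variables (h : hyperoct N) (f : {lrmorphism A -> K^o}).
Hypothesis f_u : forall i j, f (u i j) = signed_perm_mx K h i j.

Definition cube_sign (e a : {ffun 'I_N -> bool}) : K := \prod_(i < N | a i) (-1) ^+ e i.

Lemma signed_perm_mxE i j :
  signed_perm_mx K h i j = (-1) ^+ h.2 i * (h.1 i == j)%:R.
Proof. by rewrite /signed_perm_mx mul_diag_mx !mxE. Qed.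

(** The signed permutation h sends each generator to a generator up to a sign; as
    Phi is multiplicative, it permutes the group elements up to a sign too. *)
Lemma eval_Phi a b :
  f (Phi u a b) = cube_sign h.2 a * (b == cube_act h.1 a)%:R.
Proof.
(* The exclusive or of the images of the generators in the product; over all of
   'I_N the images are distinct, and it is the image of a. *)
suff eval_prod (l : seq 'I_N) g :
    f ((\prod_(r <- l | a r) gen u r) g)
    = (\prod_(r <- l | a r) (-1) ^+ h.2 r)
      * (g == [ffun j => \big[addb/false]_(r <- l | a r) (j == h.1 r)])%:R.
  rewrite PhiE eval_prod; congr (_ * (_ == _)%:R); apply/ffunP => j.
  rewrite !ffunE big_mkcond (bigD1 ((h.1^-1)%g j)) //= permKV eqxx.
  rewrite big1 => [|r nrj]; first by rewrite addbF; case: (a _).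
  case: (a r) => //; apply: contraNF nrj => /eqP ->.
  by rewrite permK.
elim: l g => [|r l IHl] g.
  rewrite !big_nil cube_alg1E mul1r rmorph_nat; congr (_ == _)%:R.
  by apply/ffunP => j; rewrite !ffunE big_nil.
rewrite !big_cons; case: ifP => ar; last first.
  rewrite IHl; congr (_ * (_ == _)%:R).
  by apply/ffunP => j; rewrite !ffunE big_cons ar.
rewrite gen_mulE raddf_sum /= (bigD1 (h.1 r)) //= [X in _ + X]big1 => [|j njr].
  rewrite addr0 rmorphM /= IHl f_u signed_perm_mxE eqxx mulr1 mulrA.
  congr (_ * (_)%:R).
  rewrite (can2_eq (cubeDK _) (cubeDK _)); congr (nat_of_bool (_ == _)).
  by apply/ffunP => j; rewrite !ffunE big_cons ar.
by rewrite rmorphM /= f_u signed_perm_mxE eq_sym (negbTE njr) mulr0 mul0r.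
Qed.

Lemma fixed_vector_eval k (xi : {ffun k.-tuple (cube N) -> K^o})
    (t : k.-tuple (cube N)) :
  fixed_vector (Phi u) xi ->
  xi t = (\prod_(s < k) cube_sign h.2 (tnth t s))
         * xi [tuple cube_act h.1 (tnth t s) | s < k].
Proof.
move=> /(_ t) /(congr1 f); rewrite linearZ /= rmorph1 [_ *: 1]mulr1 => <-.
rewrite linear_sum /= (bigD1 [tuple cube_act h.1 (tnth t s) | s < k]) //=.
rewrite [X in _ + X]big1 ?addr0 => [|j njt]; rewrite linearZ /= rmorph_prod /=.
  rewrite [_ *: _]mulrC; congr (_ * _); apply: eq_bigr => s _.
  by rewrite eval_Phi tnth_mktuple eqxx mulr1.
under eq_bigr => s _ do rewrite eval_Phi -(tnth_mktuple (fun s => cube_act h.1 (tnth t s)) s).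
by rewrite big_split /= prod_tuple_eq (negbTE njt) mulr0 scaler0.
Qed.

End Points.

(** The inclusion of H_N into the quantum group, on the level of points: evaluation
    at a signed permutation matrix is a character of A. *)
Definition hyperoct_points (K : fieldType) (N : nat) (A : algType K)
    (u : 'M[A]_N) : Prop :=
  forall h : hyperoct N, exists f : {lrmorphism A -> K^o},
    forall i j, f (u i j) = signed_perm_mx K h i j.

Section FixedVectors.
Variables (K : fieldType) (N : nat) (A : algType K) (u : 'M[A]_N).
Hypothesis char0 : [pchar K] =i pred0.
Hypothesis orth_u : u *m u^T = 1%:M.
Hypothesis anti_u : forall i j k l, (i, j) != (k, l) -> (i == k) || (j == l) ->
  u i j * u k l = - (u k l * u i j).
Hypothesis comm_u : forall i j k l, i != k -> j != l ->
  u i j * u k l = u k l * u i j.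
Hypothesis points_u : hyperoct_points u.

(** The diagonal matrix with sole entry -1 at i multiplies the coordinate of index
    t by (-1) to the number of components of t that involve g_i. *)
Lemma fixed_vector_sign k (xi : {ffun k.-tuple (cube N) -> K^o})
    (t : k.-tuple (cube N)) (i : 'I_N) :
  fixed_vector (Phi u) xi -> odd (\sum_(s < k) tnth t s i) -> xi t = 0.
Proof.
move=> fix_xi odd_t; have [f f_u] := points_u (1%g, cube1 i).
have act1 (a : cube N) : cube_act 1 a = a.
  by apply/ffunP => j; rewrite ffunE invg1 perm1.
have sign1 (a : cube N) : cube_sign K (cube1 i) a = (-1) ^+ a i.
  rewrite /cube_sign big_mkcond (bigD1 i) //= cube1E eqxx big1 => [|j nji].
    by rewrite mulr1; case: (a i).
  by rewrite cube1E (negbTE nji); case: (a j).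
have := fixed_vector_eval f_u t fix_xi; rewrite /=.
under eq_bigr => s _ do rewrite sign1.
have -> : [tuple cube_act 1 (tnth t s) | s < k] = t.
  by apply: eq_from_tnth => s; rewrite tnth_mktuple act1.
rewrite -expr_sum -signr_odd odd_t expr1 mulN1r => xtN.
exact: (eq_oppr_eq0 (A := K^o) char0).
Qed.

Lemma fixed_vector_perm k (xi : {ffun k.-tuple (cube N) -> K^o})
    (t : k.-tuple (cube N)) (s : 'S_N) :
  fixed_vector (Phi u) xi -> xi [tuple cube_act s (tnth t r) | r < k] = xi t.
Proof.
move=> fix_xi; have [f f_u] := points_u (s, cube0).
rewrite [RHS](fixed_vector_eval f_u t fix_xi) /= big1 ?mul1r // => r _.
by rewrite /cube_sign big1 // => i _; rewrite ffunE.
Qed.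

(** The unit of the group is fixed because Phi preserves the degree, and the signs
    exclude every other basis element. *)
Lemma nb_orbitals1_Phi : nb_orbitals (Phi u) 1 1.
Proof.
pose t0 : 1.-tuple (cube N) := [tuple cube0].
apply: (nb_orbitals_dual_family (p := fun _ => t0)
  (eta := fun=> [ffun t => (t == t0)%:R])).
- move=> _ t; case/tupleP: t => a t; rewrite [t]tuple0 {t}.
  rewrite sum_tuple1 (bigD1 cube0) //= [X in _ + X]big1 => [|b nb0].
    rewrite addr0 !ffunE (eqxx t0) scale1r big_ord1 !tnth0 Phi_to_cube0 //.
    rewrite -[in RHS]val_eqE /= eqseq_cons andbT.
    by case: eqP => _; rewrite ?scale1r ?scale0r.
  by rewrite ffunE -val_eqE /= eqseq_cons andbT (negbTE nb0) scale0r.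
- by move=> r q; rewrite ffunE eqxx [r]ord1 [q]ord1.
- move=> xi fix_xi; apply/ffunP => t; rewrite big_ord1 !ffunE.
  case/tupleP: t => a t; rewrite [t]tuple0 {t}.
  rewrite -val_eqE /= eqseq_cons andbT.
  have [->|] := eqVneq a cube0; first by rewrite [_ *: _]mulr1.
  rewrite scaler0 => na0.
  have [i ai] := cube_neq0 na0.
  by apply: (fixed_vector_sign (i := i) fix_xi); rewrite big_ord1 tnth0 ai.
Qed.

(** The signs confine a fixed vector to the diagonal pairs (a, a), and the
    permutations make its coordinate there depend on the weight of a only.
    Conversely, the sum of the pairs (a, a) with a of weight d is fixed: by
    degree preservation it is the homogeneous part of the relation
    Phi_orthogonal. *)
Lemma nb_orbitals2_Phi : nb_orbitals (Phi u) 2 N.+1.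
Proof.
pose diag (a : cube N) : 2.-tuple (cube N) := [tuple a; a].
apply: (nb_orbitals_dual_family (p := fun d : 'I_N.+1 => diag (initial_cube N d))
  (eta := fun d : 'I_N.+1 => [ffun t : 2.-tuple (cube N) =>
     ((tnth t ord0 == tnth t ord_max) && (weight (tnth t ord0) == d))%:R])).
- move=> d; elim/tuple2P => a b; rewrite sum_tuple2 ffunE !tnth_pair.
  transitivity ((weight a == d)%:R *: \sum_g Phi u a g * Phi u b g).
    rewrite scaler_sumr; apply: eq_bigr => g _.
    rewrite (bigD1 g) //= [X in _ + X]big1 => [|l nlg].
      rewrite addr0 ffunE big_ord2 !tnth_pair eqxx /=.
      have [->//|nwag] := eqVneq (weight a) (weight g).
      by rewrite Phi_graded // mul0r !scaler0.
    by rewrite ffunE !tnth_pair eq_sym (negbTE nlg) scale0r.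
  rewrite Phi_orthogonal //; case: (a == b) (weight a == d) => [] [] //=;
    by rewrite ?scaler0 ?scale0r.
- move=> d q; rewrite ffunE !tnth_pair eqxx weight_initial_cube; last by rewrite -ltnS.
  by rewrite eq_sym.
- move=> xi fix_xi; apply/ffunP; elim/tuple2P => a b; rewrite sum_ffunE.
  have [<-|nab] := eqVneq a b.
    pose d : 'I_N.+1 := Ordinal (weight_le a : (weight a < N.+1)%N).
    rewrite (bigD1 d) //= [X in _ + X]big1 => [|q nqd].
      rewrite addr0 !ffunE !tnth_pair (eqxx a) (eqxx (weight a)) [_ *: _]mulr1.
      have [s <-] : exists s, cube_act s a = initial_cube N d.
        by apply: cube_act_transitive; rewrite weight_initial_cube ?weight_le.
      rewrite -(fixed_vector_perm [tuple a; a] s fix_xi); congr (xi _).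
      apply: eq_from_tnth => r; rewrite tnth_mktuple.
      by case: r => [[|[|]]].
    rewrite !ffunE !tnth_pair (eqxx a); case: eqP => [wq|_]; last exact: scaler0.
    by case/eqP: nqd; apply: val_inj; exact/esym.
  rewrite big1 => [|d _]; last by rewrite !ffunE !tnth_pair (negbTE nab) scaler0.
  have [i abi] := cube_neq nab.
  apply: (fixed_vector_sign (i := i) fix_xi).
  rewrite big_ord2 !tnth_pair.
  by case: (a i) (b i) abi => [] [].
Qed.

End FixedVectors.

(** * The Fourier transform of the cube *)

Section Fourier.
Variables (K : fieldType) (N : nat).
Hypothesis char0 : [pchar K] =i pred0.
Implicit Types g h a : cube N.

Lemma fourierC g h : fourier K g h = fourier K h g.
Proof. by rewrite /fourier; under eq_bigr => a _ do rewrite andbC. Qed.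

Lemma fourierD g h a : fourier K (cubeD g h) a = fourier K g a * fourier K h a.
Proof.
rewrite /fourier !expr_sum -big_split; apply: eq_bigr => i _ /=.
rewrite ffunE; case: (g i) (h i) (a i) => [] [] [] //=;
by rewrite ?expr0 ?expr1 ?mulr1 ?mul1r ?mulrNN ?mulr1.
Qed.

Lemma fourier_sum g : \sum_a fourier K g a = (2 ^ N)%:R * (g == cube0)%:R.
Proof.
have [->|ng0] := eqVneq g cube0.
  rewrite (eq_bigr (fun=> 1)) => [|a _].
    by rewrite sumr_const card_ffun card_bool card_ord mulr1.
  by rewrite /fourier big1 ?expr0 // => i _; rewrite ffunE.
have [i gi] := cube_neq0 ng0.
rewrite mulr0; set S := \sum_a _.
(* Translation by g_i multiplies every term by -1. *)
have SN : S = - S.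
  rewrite {1}/S (reindex_inj (can_inj (cubeDK (cube1 i)))) /= -sumrN.
  apply: eq_bigr => a _; rewrite fourierC fourierD -mulN1r [fourier _ a _]fourierC.
  congr (_ * _); rewrite /fourier (bigD1 i) //= cube1E eqxx gi big1 => [|j nji].
    by rewrite expr1.
  by rewrite cube1E (negbTE nji).
exact: (eq_oppr_eq0 (A := K^o) char0).
Qed.

Definition fourier_inv g h : K := ((2 ^ N)%:R)^-1 * fourier K g h.

Lemma fourier_inverse :
  inverse_kernels (fourier K (N := N)) fourier_inv /\
  inverse_kernels fourier_inv (fourier K (N := N)).
Proof.
have two_neq0 : (2 ^ N)%:R != 0 :> K.
  by rewrite ((pcharf0P _).1 char0) expn_eq0.
have sum_fourier g h : \sum_a fourier K g a * fourier K a h = (2 ^ N)%:R * (g == h)%:R.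
  rewrite -cubeD_eq0 -fourier_sum; apply: eq_bigr => a _.
  by rewrite fourierD [fourier K a h]fourierC.
split=> g h.
  under eq_bigr => a _ do rewrite mulrCA.
  by rewrite -mulr_sumr sum_fourier mulrA mulVf // mul1r.
under eq_bigr => a _ do rewrite -mulrA.
by rewrite -mulr_sumr sum_fourier mulrA mulVf // mul1r.
Qed.

Lemma nb_orbitals_cube_magic (A : algType K) (u : 'M[A]_N) k d :
  nb_orbitals (Phi u) k d -> nb_orbitals (cube_magic u) k d.
Proof.
have [FF' F'F] := fourier_inverse; apply: nb_orbitals_conj FF' F'F _ => i j.
rewrite /cube_magic scaler_sumr; apply: eq_bigr => a _.
by rewrite scaler_sumr; apply: eq_bigr => b _; rewrite scalerA mulrCA.
Qed.

End Fourier.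

Lemma cube_magic_orbitals (K : fieldType) (N : nat) (A : algType K) (u : 'M[A]_N) :
  [pchar K] =i pred0 ->
  u *m u^T = 1%:M ->
  (forall i j k l, (i, j) != (k, l) -> (i == k) || (j == l) ->
     u i j * u k l = - (u k l * u i j)) ->
  (forall i j k l, i != k -> j != l -> u i j * u k l = u k l * u i j) ->
  hyperoct_points u ->
  nb_orbitals (cube_magic u) 1 1 /\ nb_orbitals (cube_magic u) 2 N.+1.
Proof.
move=> char0 orth_u anti_u comm_u points_u; split; apply: nb_orbitals_cube_magic => //.
  exact: nb_orbitals1_Phi.
exact: nb_orbitals2_Phi.
Qed.

(** * The hyperoctahedral group *)

Section SignedPermutations.
Variables (K : fieldType) (N : nat).

Lemma signed_perm_mx_orthogonal (h : hyperoct N) :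
  signed_perm_mx K h *m (signed_perm_mx K h)^T = 1%:M.
Proof.
apply/matrixP => i k; rewrite mxE [RHS]mxE (bigD1 (h.1 i)) //= big1 => [|j njhi].
  rewrite [_^T _ _]mxE !signed_perm_mxE eqxx mulr1 addr0 (inj_eq perm_inj) eq_sym.
  by case: eqP => [->|_]; rewrite ?mulr0 // mulr1 -expr2 sqrr_sign.
by rewrite signed_perm_mxE eq_sym (negbTE njhi) mulr0 mul0r.
Qed.

(** A signed permutation matrix has one nonzero entry in each row and column, so
    the entries that should anticommute have product zero. *)
Lemma signed_perm_mx_disjoint (h : hyperoct N) i j k l :
  (i, j) != (k, l) -> (i == k) || (j == l) ->
  signed_perm_mx K h i j * signed_perm_mx K h k l = 0.
Proof.
move=> nijkl; rewrite !signed_perm_mxE.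
have [hij|_] := eqVneq (h.1 i) j; last by rewrite mulr0 mul0r.
have [hkl|_] := eqVneq (h.1 k) l; last by rewrite !mulr0.
move: nijkl; rewrite -hij -hkl xpair_eqE (inj_eq perm_inj) andbb orbb.
by move=> /negbTE ->.
Qed.

Definition hyperoct_eval (h : hyperoct N) (x : C_hyperoct K N) : K^o := x h.

Fact hyperoct_eval_is_linear h : linear (hyperoct_eval h).
Proof. by move=> c x y; rewrite /hyperoct_eval !ffunE. Qed.
Fact hyperoct_eval_is_monoid_morphism h : monoid_morphism (hyperoct_eval h).
Proof. by split=> [|x y]; rewrite /hyperoct_eval !ffunE. Qed.
HB.instance Definition _ h := GRing.isLinear.Build K (C_hyperoct K N) K^o *:%R
  (hyperoct_eval h) (hyperoct_eval_is_linear h).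
HB.instance Definition _ h := GRing.isMonoidMorphism.Build (C_hyperoct K N) K^o
  (hyperoct_eval h) (hyperoct_eval_is_monoid_morphism h).

Lemma hyperoct_uE i j h : hyperoct_u K N i j h = signed_perm_mx K h i j.
Proof. by rewrite mxE ffunE. Qed.

Lemma hyperoct_u_points : hyperoct_points (hyperoct_u K N).
Proof. by move=> h; exists (hyperoct_eval h) => i j; exact: hyperoct_uE. Qed.

Lemma hyperoct_u_orthogonal : hyperoct_u K N *m (hyperoct_u K N)^T = 1%:M.
Proof.
apply/matrixP => i k; apply/ffunP => h.
have /matrixP /(_ i k) := signed_perm_mx_orthogonal h.
rewrite mxE [RHS]mxE => orth_ik; rewrite mxE [1%:M i k]mxE sum_ffunE.
transitivity ((i == k)%:R : K).
  rewrite -orth_ik; apply: eq_bigr => j _.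
  by rewrite ffunE ![_^T _ _]mxE !hyperoct_uE.
by case: (i == k); rewrite ffunE.
Qed.

Lemma hyperoct_u_anticommute i j k l : (i, j) != (k, l) -> (i == k) || (j == l) ->
  hyperoct_u K N i j * hyperoct_u K N k l = - (hyperoct_u K N k l * hyperoct_u K N i j).
Proof.
move=> nijkl row_or_col; apply/ffunP => h; rewrite !ffunE !hyperoct_uE.
by rewrite [X in - X]mulrC signed_perm_mx_disjoint // oppr0.
Qed.

Lemma hyperoct_u_commute i j k l :
  hyperoct_u K N i j * hyperoct_u K N k l = hyperoct_u K N k l * hyperoct_u K N i j.
Proof. by apply/ffunP => h; rewrite !ffunE mulrC. Qed.

End SignedPermutations.

(** * Characters of the universal algebra *)

Section Complex.
Variable R : realType.

(** The limit is the supremum of the eventual lower bounds of the sequence. *)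
Lemma real_complete : complete_norm (fun x : R => `|x|).
Proof.
move=> x x_cauchy.
pose S : set R := fun y => exists n0 : nat, forall n, (n0 <= n)%N -> y <= x n.
have S_approx e : 0 < e -> exists n0 : nat,
    [/\ S (x n0 - e), forall y, S y -> y <= x n0 + e
      & forall n, (n0 <= n)%N -> `|x n - x n0| < e].
  move=> /x_cauchy [n0 x_n0]; exists n0; split => [|y [n1 y_le]|n le_n0n].
  - by exists n0 => n le_n0n; have := x_n0 n n0 le_n0n (leqnn _); rewrite ltr_norml; lra.
  - have := x_n0 (maxn n0 n1) n0 (leq_maxl _ _) (leqnn _).
    by have := y_le (maxn n0 n1) (leq_maxr _ _); rewrite ltr_norml; lra.
  - exact: x_n0.
have S_sup : has_sup S.
  have [n0 [S_n0 ub_n0 _]] := S_approx 1 ltr01.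
  by split; [exists (x n0 - 1) | exists (x n0 + 1)].
exists (sup S) => e e_gt0.
have [n0 [S_n0 ub_n0 x_n0]] := S_approx (e / 2) ltac:(lra).
exists n0 => n /x_n0.
have := sup_upper_bound S_sup S_n0.
have := ge_sup S_sup.1 ub_n0.
by rewrite !ltr_norml; lra.
Qed.

Lemma normc_Re (z : R[i]) : `|complex.Re z| <= normc z.
Proof.
case: z => a b /=; rewrite -sqrtr_sqr ler_sqrt ?lerDl ?sqr_ge0 //.
by rewrite addr_ge0 ?sqr_ge0.
Qed.

Lemma normc_Im (z : R[i]) : `|complex.Im z| <= normc z.
Proof.
case: z => a b /=; rewrite -sqrtr_sqr ler_sqrt ?lerDr ?sqr_ge0 //.
by rewrite addr_ge0 ?sqr_ge0.
Qed.

Lemma normc_le (z : R[i]) : normc z <= `|complex.Re z| + `|complex.Im z|.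
Proof.
case: z => a b /=; rewrite -[leRHS]ger0_norm ?addr_ge0 // -sqrtr_sqr.
rewrite ler_sqrt ?sqr_ge0 // -(real_normK (num_real a)) -(real_normK (num_real b)).
by rewrite sqrrD -addrA lerD2l lerDr mulrn_wge0 // mulr_ge0.
Qed.

Lemma complex_complete : complete_norm (@normc R).
Proof.
move=> z z_cauchy.
have part_cauchy (p : R[i] -> R) : (forall x y, p (x - y) = p x - p y) ->
    (forall x, `|p x| <= normc x) ->
    exists l, forall e, 0 < e -> exists n0 : nat, forall n : nat,
      (n0 <= n)%N -> `|p (z n) - l| < e.
  move=> pB p_le; apply: (real_complete (x := fun n => p (z n))) => e /z_cauchy [n0 z_n0].
  exists n0 => m n le_m le_n; rewrite -pB; exact: le_lt_trans (p_le _) (z_n0 _ _ le_m le_n).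
have [] := part_cauchy (@complex.Re R) _ normc_Re; first by move=> [? ?] [? ?].
move=> a a_lim.
have [] := part_cauchy (@complex.Im R) _ normc_Im; first by move=> [? ?] [? ?].
move=> b b_lim.
exists (a +i* b)%C => e e_gt0.
have [na a_na] := a_lim (e / 2) ltac:(lra).
have [nb b_nb] := b_lim (e / 2) ltac:(lra).
exists (maxn na nb) => n; rewrite geq_max => /andP [/a_na za /b_nb zb].
apply: le_lt_trans (normc_le _) _; rewrite [e](splitr e).
by move: za zb; case: (z n) => c d /=; exact: ltrD.
Qed.

Lemma normc_conj (z : R[i]) : normc z^* = normc z.
Proof. by case: z => a b /=; rewrite sqrrN. Qed.

Definition complex_cstarAlg : cstarAlgType R.
Proof.
refine (@CStarAlg R (R[i]^o : algType R[i]) (fun z => z^* : R[i]) (@normc R)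
  _ _ _ _ _ _ _ _ _ complex_complete _).
- exact: conjCK.
- exact: rmorphD.
- exact: rmorphM.
- by move=> x y /=; rewrite rmorphM mulrC.
- by case=> a b /=; exact: sqrtr_ge0.
- exact: eq0_normc.
- exact: le_normcD.
- exact: normcM.
- by move=> x y; rewrite normcM.
- by move=> x; rewrite normcM normc_conj.
Defined.

Lemma signed_perm_mx_relations (N : nat) (h : hyperoct N) :
  @Obar_relations R N complex_cstarAlg (signed_perm_mx R[i] h).
Proof.
have orth := signed_perm_mx_orthogonal R[i] h.
split=> [i j||i j k l nijkl row_or_col|i j k l _ _].
- by rewrite /= signed_perm_mxE rmorphM rmorph_sign rmorph_nat.
- by split; [exact: orth | exact: mulmx1C orth].
- transitivity (0 : R[i]); first exact: signed_perm_mx_disjoint.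
  rewrite [X in - X]mulrC; apply/esym/eqP; rewrite oppr_eq0; apply/eqP.
  exact: signed_perm_mx_disjoint.
- exact: mulrC.
Qed.

End Complex.

(** A character of the universal algebra is a solution of its relations in the
    complex numbers. *)
Lemma Obar_points (R : realType) (N : nat) (A : cstarAlgType R) (u : 'M[A]_N) :
  is_C_Obar u -> hyperoct_points u.
Proof.
move=> [_ univ] h.
have [[f [_ f_u]] _] := univ _ _ (signed_perm_mx_relations R h).
by exists f.
Qed.

Theorem proposition8p1 (R : realType) (N : nat) (hN : (1 <= N)%N) :
  (nb_orbitals (cube_magic (hyperoct_u R[i] N)) 1 1 /\
   forall (A : cstarAlgType R) (u : 'M[A]_N), is_C_Obar u ->
     nb_orbitals (cube_magic u) 1 1) /\
  (nb_orbitals (cube_magic (hyperoct_u R[i] N)) 2 N.+1 /\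
   forall (A : cstarAlgType R) (u : 'M[A]_N), is_C_Obar u ->
     nb_orbitals (cube_magic u) 2 N.+1).
Proof.
have char0 : [pchar R[i]] =i pred0 by exact: pchar_num.
have [H1 H2] := cube_magic_orbitals char0 (hyperoct_u_orthogonal _ _)
  (@hyperoct_u_anticommute _ _) (fun i j k l _ _ => hyperoct_u_commute _ i j k l)
  (@hyperoct_u_points R[i] N).
have O12 (A : cstarAlgType R) (u : 'M[A]_N) : is_C_Obar u ->
    nb_orbitals (cube_magic u) 1 1 /\ nb_orbitals (cube_magic u) 2 N.+1.
  move=> Cu; have [[_ [orth_u _] anti_u comm_u] _] := Cu.
  exact: cube_magic_orbitals char0 orth_u anti_u comm_u (Obar_points Cu).
by split; split=> // A u /O12 [].
Qed.
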